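(* Let $G=(V,E)$ be a finite simple connected graph with $n=|V|$. A vector $x\in\mathbb R^E$ is a vertex of $\Theta(G)$ if and only if the following two conditions hold: (i) $x\in P(G)$ and $d_v(x)\le 2$ for every $v\in V$. (ii) There exist a laminar family $\mathcal L\subseteq 2^E\setminus\{\emptyset,E\}$, a set $Z\subseteq E$, and a set $D\subseteq V$ such that $x$ is the unique solution in $\mathbb R^E$ of the system of linear equations $$x(E)=n-1,\qquad x(F)=r_G(F)\ \ (F\in\mathcal L),\qquad x_f=0\ \ (f\in Z),\qquad d_v(x)=2\ \ (v\in D).$$
   Context: For $x\in\mathbb R^E$ and $F\subseteq E$, $x(F)=\sum_{e\in F}x_e$; for $v\in V$, $d_v(x)=\sum_{u:\,uv\in E}x_{uv}$. For $F\subseteq E$, $r_G(F)=n-\kappa_G(F)$, where $\kappa_G(F)$ is the number of connected components of the spanning subgraph $(V,F)$ (the rank function of the graphic matroid of $G$). The spanning tree polytope is $P(G)=\operatorname{conv}\{\chi^T: T \text{ a spanning tree of } G\}\subseteq\mathbb R^E$, where $\chi^T\in\{0,1\}^E$ is the incidence vector of the edge set of $T$. The matching polytope is $M(G)=\operatorname{conv}\{\chi^M: M\subseteq E\text{ a matching}\}$. The tree double matching polytope is $\Theta(G)=P(G)\cap 2M(G)$; equivalently, $\Theta(G)=P(G)\cap\{x: d_v(x)\le 2\text{ for every }v\in V\}$. A family $\mathcal L\subseteq 2^E$ is laminar if any two of its members are either disjoint or one contains the other. *)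

(* Defs.v *)
From HB Require Import structures.
From mathcomp Require Import all_boot all_order all_algebra.
From mathcomp Require Export reals.
Set Implicit Arguments.
Unset Strict Implicit.
Unset Printing Implicit Defensive.
Import Order.TTheory GRing.Theory Num.Theory.
Local Open Scope ring_scope.

Section Polyhedra.
Variables (R : realType) (U : lmodType R).
Implicit Types (S : U -> Prop) (x : U).

Definition conv S x : Prop :=
  exists (k : nat) (c : 'I_k -> R) (p : 'I_k -> U),
    [/\ forall i, 0 <= c i,
        \sum_(i < k) c i = 1,
        forall i, S (p i)
      & x = \sum_(i < k) c i *: p i].

(* Vertices are taken to be extreme points. *)
Definition is_vertex S x : Prop :=
  S x /\ forall (y z : U) (t : R), S y -> S z -> 0 < t < 1 ->
           x = t *: y + (1 - t) *: z -> y = z.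

End Polyhedra.

Record sgraph := SGraph {
  sg_vertex :> finType;
  adj : rel sg_vertex;
  adj_sym : symmetric adj;
  adj_irr : irreflexive adj }.

Definition connected_graph (G : sgraph) : Prop :=
  (0 < #|G|)%N /\ forall u v : G, connect (@adj G) u v.

Definition edge_set (G : sgraph) : {set {set G}} :=
  [set [set p.1; p.2] | p : G * G & adj p.1 p.2].

(* Vectors of R^E are finite functions {ffun edge G -> R^o}; R^o is R seen as a
   module over itself, which gives R^E its scaling operation. *)
Definition edge (G : sgraph) : finType := {f : {set G} | f \in edge_set G}.

Section Graph.
Variable G : sgraph.
Implicit Types (F T M : {set edge G}) (v : G).

Definition sub_adj F : rel G := fun u v => [exists f in F, val f == [set u; v]].

Definition kappa F : nat := n_comp (sub_adj F) predT.

(* The natural-number subtraction never truncates: kappa F <= #|G|. *)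
Definition graph_rank F : nat := (#|G| - kappa F)%N.

(* The graph (V, T) is connected, and it has no cycle: ucycle is a closed walk
   with pairwise distinct vertices, which in a simple graph is a cycle exactly
   when it has at least 3 vertices. *)
Definition spanning_tree T : Prop :=
  (forall u v : G, connect (sub_adj T) u v) /\
  (forall c : seq G, ucycle (sub_adj T) c -> (size c <= 2)%N).

Definition matching M : Prop :=
  forall f g : edge G, f \in M -> g \in M -> f != g -> [disjoint val f & val g].

Definition laminar (L : {set {set edge G}}) : Prop :=
  forall A B : {set edge G}, A \in L -> B \in L ->
    [\/ [disjoint A & B], A \subset B | B \subset A].

Section Polytopes.
Variable R : realType.
Implicit Types x : {ffun edge G -> R^o}.

Definition incidence F : {ffun edge G -> R^o} := [ffun f => (f \in F)%:R].

Definition weight x F : R := \sum_(f in F) x f.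

Definition deg v x : R := \sum_(f : edge G | v \in val f) x f.

Definition linear_system (L : {set {set edge G}}) (Z : {set edge G})
    (D : {set G}) x : Prop :=
  [/\ weight x [set: edge G] = #|G|%:R - 1,
      forall F, F \in L -> weight x F = (graph_rank F)%:R,
      forall f, f \in Z -> x f = 0
    & forall v, v \in D -> deg v x = 2].

Definition tree_polytope x : Prop :=
  conv (fun y => exists2 T, spanning_tree T & y = incidence T) x.

Definition matching_polytope x : Prop :=
  conv (fun y => exists2 M, matching M & y = incidence M) x.

Definition tree_double_matching_polytope x : Prop :=
  tree_polytope x /\ exists2 y, matching_polytope y & x = 2 *: y.

End Polytopes.
End Graph.

(* Main.v *)
Require Import Defs.
From mathcomp Require Import all_boot all_order all_algebra.
From mathcomp Require Import boolp ring lra zify.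
Set Implicit Arguments.
Unset Strict Implicit.
Unset Printing Implicit Defensive.
Import Order.TTheory GRing.Theory Num.Theory.
Local Open Scope ring_scope.

(** A vertex of a polytope is a point at which the tight constraints determine
    it, so the theorem rests on descriptions of both polytopes by inequalities
    and on a way to thin out the tight constraints.

    The spanning tree polytope is the set of x with x(E) = n - 1 and
    x(F) <= r(F) for all F ([tree_polytopeP]): for a weight w, a spanning tree T
    of maximal weight meets every superlevel set of w in as many edges as the
    rank allows, and Abel summation over the superlevel sets gives
    w.x <= w(T); separation of a point from a finite convex hull
    ([conv_separation], from Farkas' lemma) concludes.

    A point x of that polytope with all degrees at most 2 is twice a point of
    the matching polytope ([tree_double_matching_polytopeP]). Indeed x(F) <= r(F),
    for F the edges inside a vertex set U, gives x(E[U]) <= |U| - 1, so x/2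
    satisfies Edmonds' odd set inequalities. That those suffice
    ([matching_polytope_sufficient]) is shown as Lovasz does: for a
    nonzero w, the matchings of maximal weight all satisfy one and the same of
    Edmonds' inequalities with equality. The lemma [conv_facets] turns this property
    into membership in the convex hull.

    If x satisfies (i) and (ii), any segment of the polytope around x lies in
    all tight hyperplanes, so its ends solve the linear system and coincide with x.
    Conversely, let x be a vertex. By submodularity the sets F with
    x(F) = r(F) form a lattice; let L be a maximal chain in it, deprived of the
    empty set and of E, let D be the set of v with d_v(x) = 2, and let Z be
    empty. A direction h that the system for L and D does not see vanishes on
    every tight set ([sum_eq0_maxchain]), so x + t h and x - t h satisfy all
    inequalities for small t > 0, and h = 0 since x is a vertex. *)

(** * Finite convex hulls: Farkas' lemma, separation and facets *)

(** Bartl's induction on the number of functionals. If the inequality of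
    the first functional is needed, some [x0] satisfies all the others but
    violates the conclusion; projecting along [x0] onto the kernel of the first
    functional reduces to one functional less. *)
Lemma farkas (R : realFieldType) (U : lmodType R) m (a : 'I_m -> U -> R)
    (c : U -> R) :
  (forall i, scalar (a i)) -> scalar c ->
  (forall x, (forall i, a i x <= 0) -> c x <= 0) ->
  exists2 l : 'I_m -> R, forall i, 0 <= l i &
    forall x, c x = \sum_i l i * a i x.
Proof.
elim: m a c => [|m IH] a c ha hc H.
  exists (fun=> 0) => // x; rewrite big_ord0.
  have le0 z : c z <= 0 by apply: H => -[].
  have c0 : c 0 = 0.
    by have := hc 1 0 0; rewrite scale1r add0r mul1r; lra.
  have := hc (-1) x 0; rewrite addr0 c0 => cN.
  by have := le0 (-1 *: x); rewrite cN; have := le0 x; lra.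
pose a' i := a (lift ord0 i).
have [Hc|] := pselect (forall x, (forall i, a' i x <= 0) -> c x <= 0).
  have [l l0 lE] := IH a' c (fun i => ha _) hc Hc.
  exists (fun i => if unlift ord0 i is Some j then l j else 0) => [i|x].
    by case: unliftP.
  rewrite big_ord_recl unlift_none mul0r add0r lE.
  by apply: eq_bigr => i _; rewrite liftK.
move=> /existsNP[x0 /not_implyP[ax0 /negP]]; rewrite -ltNge => cx0.
have a0x0 : 0 < a ord0 x0.
  rewrite ltNge; apply/negP => a0; suff: c x0 <= 0 by rewrite leNgt cx0.
  by apply: H => i; case: (unliftP ord0 i) => [j|] ->; first exact: ax0.
(* the projection along [x0] onto the kernel of [a ord0] *)
pose pr x := - (a ord0 x / a ord0 x0) *: x0 + x.
have prE f : scalar f -> forall x, f (pr x) = f x - a ord0 x / a ord0 x0 * f x0.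
  by move=> hf x; rewrite /pr hf mulNr addrC.
have a0pr x : a ord0 (pr x) = 0 by rewrite prE // divfK ?subrr // gt_eqF.
have prL f : scalar f -> scalar (f \o pr).
  move=> hf k u v /=; rewrite !prE // ha hf; ring.
have [x hx|l l0 lE] := IH (fun i => a' i \o pr) (c \o pr)
   (fun i => prL _ (ha _)) (prL _ hc).
  by apply: H => i; case: (unliftP ord0 i) => [j|] ->; [exact: hx|rewrite a0pr].
exists (fun i => if unlift ord0 i is Some j then l j else
  (c x0 - \sum_i l i * a' i x0) / a ord0 x0) => [i|x].
  case: unliftP => // _; rewrite divr_ge0 ?(ltW a0x0) // subr_ge0.
  apply: le_trans (ltW cx0); apply: sumr_le0 => j _.
  by rewrite mulr_ge0_le0.
rewrite big_ord_recl unlift_none; set s := \sum_i l i * a' i x0.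
have -> : \sum_(i < m) (if unlift ord0 (lift ord0 i) is Some j then l j else
    (c x0 - s) / a ord0 x0) * a (lift ord0 i) x = \sum_i l i * a' i x.
  by apply: eq_bigr => i _; rewrite liftK.
have := lE x; rewrite /= prE //.
have -> : \sum_i l i * a' i (pr x) =
    \sum_i l i * a' i x - a ord0 x / a ord0 x0 * s.
  rewrite mulr_sumr -sumrB; apply: eq_bigr => i _.
  by rewrite prE ?mulrBr 1?mulrCA //; exact: ha.
by move=> /eqP; rewrite subr_eq => /eqP ->; ring.
Qed.

Section Dot.
Variables (R : realType) (E : finType).
Implicit Types w x y : {ffun E -> R^o}.

Definition dot w x : R := \sum_e w e * x e.

Lemma dotC w x : dot w x = dot x w.
Proof. by apply: eq_bigr => e _; rewrite mulrC. Qed.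

Lemma dot_linear w k x y : dot w (k *: x + y) = k * dot w x + dot w y.
Proof.
rewrite /dot mulr_sumr -big_split; apply: eq_bigr => e _ /=.
by rewrite !ffunE mulrDr mulrCA.
Qed.

Lemma dotDr w x y : dot w (x + y) = dot w x + dot w y.
Proof. by rewrite -{1}[x]scale1r dot_linear mul1r. Qed.

Lemma dot0r w : dot w 0 = 0.
Proof. by rewrite /dot big1 // => e _; rewrite ffunE mulr0. Qed.

Lemma dotZr w k x : dot w (k *: x) = k * dot w x.
Proof. by rewrite -[k *: x]addr0 dot_linear dot0r addr0. Qed.

Lemma dotBr w x y : dot w (x - y) = dot w x - dot w y.
Proof. by rewrite dotDr -scaleN1r dotZr mulN1r. Qed.

Lemma dotBl w x y : dot (w - x) y = dot w y - dot x y.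
Proof. by rewrite dotC dotBr !(dotC y). Qed.

Lemma dotZl k w x : dot (k *: w) x = k * dot w x.
Proof. by rewrite dotC dotZr dotC. Qed.

Lemma dot_sumr w (I : finType) (c : I -> R) (p : I -> {ffun E -> R^o}) :
  dot w (\sum_i c i *: p i) = \sum_i c i * dot w (p i).
Proof.
elim/big_rec2: _ => [|i s x _ IH]; first exact: dot0r.
by rewrite dot_linear IH.
Qed.

Lemma dot_conv_le (S : {ffun E -> R^o} -> Prop) w b x :
  (forall y, S y -> dot w y <= b) -> conv S x -> dot w x <= b.
Proof.
move=> Sb [k [c [p [c0 c1 pS ->]]]]; rewrite dot_sumr -[b]mul1r -c1 mulr_suml.
by apply: ler_sum => i _; apply: ler_wpM2l => //; apply: Sb.
Qed.

Variables (J : finType) (P : J -> Prop) (p : J -> {ffun E -> R^o}).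
Let S y := exists2 j, P j & y = p j.

(** Farkas' lemma on pairs (w, b): the functional w.y - b is a nonnegative
    combination of the w.(p j) - b, and the coefficient of b says that the
    combination is convex. *)
Lemma conv_separation y :
  (forall w b, (forall j, P j -> dot w (p j) <= b) -> dot w y <= b) -> conv S y.
Proof.
move=> H; pose A := [set j | `[< P j >]].
pose q (i : 'I_#|A|) := p (enum_val i).
pose phi (z : {ffun E -> R^o}) (u : {ffun E -> R^o} * R^o) : R :=
  dot z u.1 - u.2.
have phiL z : scalar (phi z).
  by move=> k [w b] [w' b']; rewrite /phi /= dot_linear (_ : k *: b = k * b) //; ring.
have [[w b] /= Hu|l l0 lE] := farkas (fun i => phiL (q i)) (phiL y).
  rewrite /phi /= subr_le0 dotC; apply: H => j Pj.
  have Aj : j \in A by rewrite inE; apply/asboolP.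
  have := Hu (enum_rank_in Aj j); rewrite /phi /q enum_rankK_in //=.
  by rewrite dotC subr_le0.
exists #|A|, l, q; split => //.
- have := lE (0, -1); rewrite /phi /= dot0r.
  by under eq_bigr do rewrite dot0r; rewrite -mulr_suml; lra.
- move=> i; exists (enum_val i) => //.
  by have := enum_valP i; rewrite inE => /asboolP.
(* the coordinate form at [e] is the dot product with a unit vector *)
apply/ffunP => e; have := lE ([ffun f => (f == e)%:R], 0); rewrite /phi /=.
have dlt z : dot z [ffun f => (f == e)%:R] = z e.
  rewrite /dot (bigD1 e) //= big1 ?ffunE ?eqxx ?mulr1 ?addr0 // => f fe.
  by rewrite ffunE (negPf fe) mulr0.
rewrite dlt subr0 sum_ffunE => ->.
by apply: eq_bigr => i _; rewrite dlt subr0 ffunE.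
Qed.

(** Membership in a convex hull follows once each inequality w.p <= b that
    is valid on the points and violated by [y] is shadowed by another valid
    inequality a.p <= d, satisfied by [y], which is tight wherever the first is
    but not everywhere. Subtracting a multiple of the second from the first
    keeps [y] separated and keeps the tight points tight; the largest multiple
    that preserves validity makes a further point tight. This replaces the
    choice of a facet that separates [y]. *)
Lemma conv_facets y :
  (forall w b, (forall j, P j -> dot w (p j) <= b) -> b < dot w y ->
    exists a d, [/\ forall j, P j -> dot a (p j) <= d, dot a y <= d,
      forall j, P j -> dot w (p j) = b -> dot a (p j) = d
      & exists2 j, P j & dot a (p j) < d]) ->
  conv S y.
Proof.
move=> H; apply: conv_separation => w b wb; rewrite leNgt; apply/negP => wy.
pose slack w b := [set j | `[< P j >] && (dot w (p j) < b)].
have [n] := ubnP #|slack w b|.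
elim: n w b wb wy => // n IH w b wb wy; rewrite ltnS => sn.
have [a [d [ad ay tight [j0 Pj0 aj0]]]] := H _ _ wb wy.
pose Q j := `[< P j >] && (dot a (p j) < d).
pose t j := (b - dot w (p j)) / (d - dot a (p j)).
have Qj0 : Q j0 by rewrite /Q aj0 andbT; apply/asboolP.
(* the least ratio of slacks is the largest admissible multiple *)
case: (arg_minP t Qj0) => j1 /andP[/asboolP Pj1 aj1] tmin.
have t_ge0 : 0 <= t j1 by rewrite divr_ge0 ?subr_ge0 ?wb ?ad.
have tE : t j1 * (d - dot a (p j1)) = b - dot w (p j1).
  by rewrite divfK // subr_eq0 gt_eqF.
have wb' j : P j -> dot (w - t j1 *: a) (p j) <= b - t j1 * d.
  move=> Pj; rewrite dotBl dotZl.
  suff : t j1 * (d - dot a (p j)) <= b - dot w (p j) by lra.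
  have [aj|aj] := ltP (dot a (p j)) d; last first.
    have -> : dot a (p j) = d by apply/le_anti; rewrite aj ad.
    by rewrite subrr mulr0 subr_ge0 wb.
  rewrite -ler_pdivlMr ?subr_gt0 //; apply: tmin.
  by rewrite /Q aj andbT; apply/asboolP.
apply: (IH (w - t j1 *: a) (b - t j1 * d)) => //.
  rewrite dotBl dotZl.
  by have := ler_wpM2l t_ge0 ay; lra.
apply: leq_trans sn; apply: proper_card; apply/properP; split.
  apply/subsetP => j; rewrite !inE => /andP[/asboolP Pj].
  rewrite lt_neqAle => /andP[ne _]; apply/andP; split; first exact/asboolP.
  rewrite lt_neqAle wb // andbT; apply: contra ne => /eqP wj.
  by rewrite dotBl dotZl wj tight.
exists j1; rewrite !inE.
  apply/andP; split; first exact/asboolP.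
  rewrite lt_neqAle wb // andbT; apply: contraTneq aj1 => wj.
  by rewrite tight ?ltxx.
by rewrite negb_and dotBl dotZl -leNgt; apply/orP; right; lra.
Qed.

End Dot.

(** * The rank function of the graphic matroid *)

Lemma set_U1_ind (T : finType) (P : {set T} -> Prop) :
  P set0 -> (forall x (A : {set T}), x \notin A -> P A -> P (x |: A)) ->
  forall A, P A.
Proof.
move=> P0 PU A; have [n] := ubnP #|A|; elim: n A => // n IH A.
have [->//|[x xA]] := set_0Vmem A.
rewrite ltnS (cardsD1 x) xA => An; rewrite -(setD1K xA).
by apply: PU; [rewrite !inE eqxx | exact: IH].
Qed.

Section GraphicRank.
Local Open Scope nat_scope.
Variable G : sgraph.
Implicit Types (A B C F T I : {set edge G}) (e f : edge G) (u v : G).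

Definition star v : {set edge G} := [set f : edge G | v \in val f].

Definition inside (U : {set G}) : {set edge G} :=
  [set f : edge G | val f \subset U].

Lemma edge_ends e : exists u v, adj u v /\ val e = [set u; v].
Proof.
have /imsetP[[u v] uv ->] := valP e; exists u, v.
by move: uv; rewrite inE.
Qed.

Lemma edge_of_adj u v : adj u v -> exists e : edge G, val e = [set u; v].
Proof.
move=> uv; have es : [set u; v] \in edge_set G.
  by apply/imsetP; exists (u, v); rewrite ?inE.
by exists (exist (fun f : {set G} => is_true (f \in edge_set G)) _ es).
Qed.

Lemma set2_inj (u v v' : G) : u != v -> [set u; v] = [set u; v'] -> v = v'.
Proof.
move=> uv E; have := set22 u v; rewrite E !inE eq_sym (negPf uv).
by move/eqP.
Qed.

Lemma sub_adjP F u v :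
  reflect (exists2 f, f \in F & val f = [set u; v]) (sub_adj F u v).
Proof.
by apply: (iffP existsP) => [[f /andP[fF /eqP]]|[f fF fE]]; exists f => //;
   rewrite fF fE eqxx.
Qed.

Lemma sub_adj_sym F : symmetric (sub_adj F).
Proof. by move=> u v; rewrite /sub_adj setUC. Qed.

Lemma sub_adj_csym F : connect_sym (sub_adj F).
Proof. exact/sym_connect_sym/sub_adj_sym. Qed.

Lemma sub_adj_adj F u v : sub_adj F u v -> adj u v.
Proof.
case/sub_adjP => f _; have [a [b [ab ->]]] := edge_ends f => E.
have : u \in [set a; b] by rewrite E set21.
have ab' : a != b by apply: contraTneq ab => ->; rewrite adj_irr.
rewrite !inE => /orP[] /eqP Eu; rewrite Eu in E *.
  by rewrite -(set2_inj ab' E).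
by move: E; rewrite setUC => /set2_inj <-; rewrite 1?eq_sym // adj_sym.
Qed.

Lemma sub_adj_irr F u : sub_adj F u u = false.
Proof. by apply: contraFF (adj_irr u); exact: sub_adj_adj. Qed.

Lemma sub_adjS A B : A \subset B -> subrel (sub_adj A) (sub_adj B).
Proof.
move=> /subsetP AB u v /sub_adjP[f /AB fB fE]; apply/sub_adjP; by exists f.
Qed.

Lemma connectS A B u v :
  A \subset B -> connect (sub_adj A) u v -> connect (sub_adj B) u v.
Proof.
move=> AB; apply: connect_sub => a b ab; apply: connect1.
exact: sub_adjS ab.
Qed.

(** The edge [e] lies in the closure of [F] in the graphic matroid. *)
Definition joins F e :=
  [forall u in val e, forall v in val e, connect (sub_adj F) u v].

Lemma joinsE F e u v : val e = [set u; v] ->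
  joins F e = connect (sub_adj F) u v.
Proof.
move=> eE; apply/idP/idP.
  move=> /forall_inP/(_ u); rewrite eE set21 => /(_ isT)/forall_inP/(_ v).
  by rewrite set22; apply.
move=> uv; apply/forall_inP => a; rewrite eE !inE => ha.
apply/forall_inP => b; rewrite !inE => hb.
by case/orP: ha hb => /eqP -> /orP[] /eqP -> //; rewrite sub_adj_csym.
Qed.

Lemma joins_in F e : e \in F -> joins F e.
Proof.
have [u [v [uv E]]] := edge_ends e => eF; rewrite (joinsE _ E) connect1 //.
by apply/sub_adjP; exists e.
Qed.

Lemma joinsS A B e : A \subset B -> joins A e -> joins B e.
Proof.
by have [u [v [_ E]]] := edge_ends e; rewrite !(joinsE _ E) => /connectS; apply.
Qed.

Lemma sub_adjU1 F e u v a b : val e = [set u; v] ->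
  sub_adj (e |: F) a b =
  [|| sub_adj F a b, (a == u) && (b == v) | (a == v) && (b == u)].
Proof.
move=> eE; apply/idP/idP.
  case/sub_adjP => f; rewrite !inE => /orP[/eqP ->|fF fE]; last first.
    by apply/orP; left; apply/sub_adjP; exists f.
  have [x [y [xy E]]] := edge_ends e.
  have uv : u != v.
    apply: contraTneq xy => uv.
    have := subxx (val e); rewrite {1}E eE uv setUid.
    by rewrite subUset !sub1set !inE => /andP[/eqP -> /eqP ->]; rewrite adj_irr.
  rewrite eE => E2; have : a \in [set u; v] by rewrite E2 set21.
  rewrite !inE => /orP[] /eqP Ea; rewrite Ea in E2 *.
    by rewrite (set2_inj uv E2) !eqxx orbT.
  by move: E2; rewrite setUC => /set2_inj <-; rewrite ?eqxx ?orbT // eq_sym.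
case/or3P => [|/andP[/eqP-> /eqP->]|/andP[/eqP-> /eqP->]].
- by apply: sub_adjS; apply: subsetUr.
- by apply/sub_adjP; exists e; rewrite ?setU11.
- by apply/sub_adjP; exists e; rewrite ?setU11 // setUC.
Qed.

(** A walk in F + e can be cut at its passages through [e], so at most one
    passage is needed. *)
Lemma connectU1 F e u v a b : val e = [set u; v] ->
  connect (sub_adj (e |: F)) a b =
  [|| connect (sub_adj F) a b,
      connect (sub_adj F) a u && connect (sub_adj F) v b
    | connect (sub_adj F) a v && connect (sub_adj F) u b].
Proof.
move=> eE; pose c := connect (sub_adj F); rewrite -/c.
have cS x y : c x y = c y x by exact: sub_adj_csym.
have cT x y z : c x y -> c y z -> c x z by exact: connect_trans.
have cc x : c x x by exact: connect0.
apply/idP/idP.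
  case/connectP => p; elim: p a => [|x p IH] a /=; first by move=> _ ->; rewrite cc.
  case/andP; rewrite (sub_adjU1 _ _ _ eE) => ax /IH h /h {}h.
  have {ax} : [|| c a x, (a == u) && (x == v) | (a == v) && (x == u)].
    by case/orP: ax => [ax|->]; rewrite ?orbT // /c connect1.
  case/or3P => [ax|/andP[/eqP -> /eqP xv]|/andP[/eqP-> /eqP xu]].
  - by case/or3P: h => [/(cT _ _ _ ax) ->|/andP[/(cT _ _ _ ax)-> ->]|
      /andP[/(cT _ _ _ ax)-> ->]] //; rewrite ?orbT.
  - by move: h; rewrite xv !cc /= => /or3P[->|/andP[_ ->]|->]; rewrite ?orbT.
  - by move: h; rewrite xu !cc /= => /or3P[->|->|/andP[_ ->]]; rewrite ?orbT.
have cF x y : c x y -> connect (sub_adj (e |: F)) x y.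
  by apply: connectS; apply: subsetUr.
have euv : connect (sub_adj (e |: F)) u v.
  by rewrite -(joinsE _ eE) joins_in ?setU11.
case/or3P => [/cF //|/andP[/cF au /cF vb]|/andP[/cF av /cF ub]].
  exact: connect_trans (connect_trans au euv) vb.
rewrite sub_adj_csym in euv.
exact: connect_trans (connect_trans av euv) ub.
Qed.

Lemma kappa_joins F e : joins F e -> kappa (e |: F) = kappa F.
Proof.
have [u [v [_ E]]] := edge_ends e; rewrite (joinsE _ E) => uv.
apply: eq_n_comp => a b; rewrite (connectU1 _ _ _ E).
apply/idP/idP => [|->//]; case/or3P => // /andP[h1 h2].
  exact: connect_trans (connect_trans h1 uv) h2.
by rewrite sub_adj_csym in uv; exact: connect_trans (connect_trans h1 uv) h2.
Qed.

(** Adding an edge between two components merges them: sending a vertex to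
    its new root is a bijection from the old roots other than that of [u] onto
    the new roots. *)
Lemma kappa_not_joins F e : ~~ joins F e -> kappa F = (kappa (e |: F)).+1.
Proof.
have [u [v [_ E]]] := edge_ends e; rewrite (joinsE _ E) => uv.
pose s := sub_adj F; pose s' := sub_adj (e |: F).
have sS : connect_sym s by exact: sub_adj_csym.
have sS' : connect_sym s' by exact: sub_adj_csym.
pose A := [set x | roots s x].
have kF : kappa F = #|A|.
  by apply: eq_card => x; rewrite !inE andbT.
have ruA : fingraph.root s u \in A by rewrite inE roots_root.
rewrite kF (cardsD1 (fingraph.root s u)) ruA add1n; congr S.
have inj : {in A :\ fingraph.root s u &, injective (fingraph.root s')}.
  move=> x y; rewrite !inE => /andP[xu /eqP xr] /andP[yu /eqP yr] /eqP.
  rewrite root_connect // (connectU1 _ _ _ E) => /or3P[].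
  - by rewrite -root_connect // xr yr => /eqP.
  - by rewrite -root_connect // xr (negPf xu).
  - by rewrite andbC -root_connect // yr eq_sym (negPf yu).
rewrite -(card_in_imset inj); apply: eq_card => x; rewrite !inE andbT.
have cS a b : connect s a b -> connect s' a b.
  by apply: connectS; apply: subsetUr.
have uv' : connect s' u v by rewrite -(joinsE _ E) joins_in ?setU11.
apply/imsetP/idP => [[y _ ->]|/eqP xr]; first exact: roots_root.
have [xu|xu] := boolP (connect s x u); last first.
  exists (fingraph.root s x).
    by rewrite !inE roots_root // andbT root_connect.
  by rewrite -{1}xr; apply/eqP; rewrite root_connect // cS // connect_root.
exists (fingraph.root s v).
  by rewrite !inE roots_root // andbT root_connect // sS.
rewrite -{1}xr; apply/eqP; rewrite root_connect //.
apply: connect_trans (cS _ _ (connect_root _ _)).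
by apply: connect_trans uv'; exact: cS.
Qed.

Lemma kappa_le F : kappa F <= #|G|.
Proof. exact: max_card. Qed.

Lemma graph_rank0 : graph_rank (set0 : {set edge G}) = 0.
Proof.
rewrite /graph_rank [kappa _](_ : _ = #|G|) ?subnn //.
apply: eq_card => x; rewrite !inE andbT; apply/eqP.
have /connectP[[|y p] /= ] := connect_root (sub_adj (set0 : {set edge G})) x.
  by [].
by case/andP => /sub_adjP[f]; rewrite inE.
Qed.

Lemma graph_rankU1 F e : graph_rank (e |: F) = graph_rank F + ~~ joins F e.
Proof.
rewrite /graph_rank; have [/kappa_joins ->|/kappa_not_joins k] := boolP (joins F e).
  by rewrite addn0.
by have := kappa_le F; rewrite k /=; lia.
Qed.

Lemma graph_rankS A B : A \subset B -> graph_rank A <= graph_rank B.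
Proof.
move=> AB; rewrite -(setUidPr AB) setUC; elim/set_U1_ind: B {AB} => [|e B _ IH].
  by rewrite set0U.
by rewrite -setUA graph_rankU1 (leq_trans IH) ?leq_addr.
Qed.

Lemma graph_rank_card A : graph_rank A <= #|A|.
Proof.
elim/set_U1_ind: A => [|e A eA IH]; first by rewrite graph_rank0.
by rewrite graph_rankU1 cardsU1 eA addnC leq_add // leq_b1.
Qed.

(** Diminishing returns: a new edge that raises the rank of the larger
    set also raises that of the smaller one, because [joins] is monotone. *)
Lemma graph_rank_diminishing A B C : A \subset B ->
  graph_rank A + graph_rank (C :|: B) <= graph_rank (C :|: A) + graph_rank B.
Proof.
move=> AB; elim/set_U1_ind: C => [|e C _ IH]; first by rewrite !set0U.
rewrite -!setUA !graph_rankU1.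
have : joins (C :|: A) e -> joins (C :|: B) e by apply: joinsS; exact: setUS.
by move: (joins _ e) (joins _ e) => [] [] //= H; move: IH; rewrite /=; lia.
Qed.

Lemma graph_rank_submod A B :
  graph_rank (A :&: B) + graph_rank (A :|: B) <= graph_rank A + graph_rank B.
Proof.
have := graph_rank_diminishing A (subsetIr A B).
by rewrite (setUidPl (subsetIl A B)).
Qed.

(** A subset whose closure contains [B] has the rank of [B]. *)
Lemma graph_rank_closed A B : A \subset B -> {in B, forall e, joins A e} ->
  graph_rank B = graph_rank A.
Proof.
move=> AB jB; have sub C : C \subset B -> graph_rank (C :|: A) = graph_rank A.
  elim/set_U1_ind: C => [|e C _ IH]; first by rewrite set0U.
  rewrite subUset sub1set => /andP[eB /IH IHC].
  rewrite -setUA graph_rankU1 IHC (joinsS _ (jB e eB)) ?addn0 //.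
  exact: subsetUr.
by rewrite -(sub B) // (setUidPl AB).
Qed.

Definition independent I := graph_rank I == #|I|.

Lemma independentS A B : A \subset B -> independent B -> independent A.
Proof.
move=> AB /eqP iB; rewrite /independent eqn_leq graph_rank_card /=.
have := graph_rank_diminishing (B :\: A) (sub0set A).
have -> : (B :\: A) :|: A = B.
  by apply/setP => e; rewrite !inE; case: (boolP (e \in A)) => [eA|_];
    rewrite ?orbF // (subsetP AB).
rewrite graph_rank0 setU0 iB.
have := graph_rank_card (B :\: A); have := cardsID A B.
rewrite (setIidPr AB); move: #|A| #|B :\: A| #|B|.
by move: (graph_rank _) (graph_rank _) => x y; lia.
Qed.

(** A maximal independent set between [I] and [A] joins every edge of
    [A]. *)
Lemma independent_extend I A : I \subset A -> independent I ->
  exists B, [/\ I \subset B, B \subset A, independent B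
              & graph_rank B = graph_rank A].
Proof.
move=> IA iI; pose P B := (B \subset A) && independent B.
have [|B /maxsetP[/andP[BA iB] max] IB] := @maxset_exists _ P I.
  by rewrite /P IA.
exists B; split => //; apply/esym/graph_rank_closed => // e eA.
apply/negPn/negP => je.
have eB : e \notin B by apply: contra je; apply: joins_in.
have := max (e |: B); rewrite /P subUset sub1set eA BA /= => /(_ _ (subsetUr _ _)).
rewrite /independent graph_rankU1 cardsU1 eB je (eqP iB) addnC eqxx => /(_ isT).
by move=> E; move: eB; rewrite -E setU11.
Qed.

Lemma connected_graph_rank F : 0 < #|G| ->
  (forall u v, connect (sub_adj F) u v) <-> graph_rank F = #|G|.-1.
Proof.
move=> G0; have sF := @sub_adj_csym F.
have -> : graph_rank F = #|G|.-1 <-> kappa F = 1.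
  have k0 : 0 < kappa F.
    have /card_gt0P[u _] := G0.
    by apply/card_gt0P; exists (fingraph.root (sub_adj F) u); rewrite !inE roots_root.
  have := kappa_le F; rewrite /graph_rank; lia.
split=> [c|].
  have /card_gt0P[u _] := G0.
  by rewrite -(n_comp_connect sF u); apply: eq_n_comp_r => v; rewrite !inE c.
move=> /eqP/card1P[x kx] u v; rewrite -root_connect //.
have := kx (fingraph.root (sub_adj F) u); have := kx (fingraph.root (sub_adj F) v).
by rewrite !inE !roots_root //= => /esym/eqP -> /esym/eqP ->.
Qed.

(** Edges can be added one at a time: a path joining the ends of a new
    edge in the previous ones would close up to a cycle. *)
Lemma forest_independent T :
  (forall c : seq G, ucycle (sub_adj T) c -> size c <= 2) -> independent T.
Proof.
move=> acyc; suff sub I : I \subset T -> independent I by exact: sub.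
elim/set_U1_ind: I => [|e I eI IH]; first by rewrite /independent graph_rank0 cards0.
rewrite subUset sub1set => /andP[eT IT].
rewrite /independent graph_rankU1 cardsU1 eI (eqP (IH IT)) addnC.
suff -> : ~~ joins I e by [].
have [u [v [uv E]]] := edge_ends e; rewrite (joinsE _ E); apply/negP => /connectP.
case=> p0 /shortenP[p pI up _] vE.
have {acyc} : size (u :: p) <= 2.
  apply: acyc; rewrite /ucycle up andbT /= rcons_path.
  rewrite (sub_path (sub_adjS IT)) //= -vE.
  by apply/sub_adjP; exists e; rewrite // setUC.
case: p pI up vE => [|a [|b p]] //=.
  by move=> _ _ vu; rewrite vu adj_irr in uv.
rewrite andbT => ua _ va _; rewrite -va in ua.
case/sub_adjP: ua => f fI; rewrite -E => /val_inj fe.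
by move: eI; rewrite -fe fI.
Qed.

(** Removing an edge of a cycle does not lower the rank, since the rest of
    the cycle still joins its ends; but the rank of an independent set is its
    cardinal. *)
Lemma independent_forest T : independent T ->
  forall c : seq G, ucycle (sub_adj T) c -> size c <= 2.
Proof.
move=> iT [|a [|b [|d c]]] //= /andP[cyc uc].
move: cyc => /= /andP[ab pb].
case/sub_adjP: ab => e eT eE.
suff je : joins (T :\ e) e.
  have := graph_rankU1 (T :\ e) e; rewrite je addn0 setD1K // (eqP iT).
  by have := graph_rank_card (T :\ e); rewrite (cardsD1 e T) eT; lia.
rewrite (joinsE _ eE) sub_adj_csym; apply/connectP.
have ab : a != b.
  by move: uc => /=; rewrite !inE !negb_or -!andbA => /andP[].
exists (rcons (d :: c) a); last by rewrite last_rcons.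
have P x y : sub_adj T x y -> [set x; y] != [set a; b] -> sub_adj (T :\ e) x y.
  move=> /sub_adjP[f fT fE] ne; apply/sub_adjP; exists f => //.
  by rewrite !inE fT andbT; apply: contra ne => /eqP fe; rewrite -fE fe eE.
move: pb; rewrite -[sub_adj T b d && _]/(path (sub_adj T) b (rcons (d :: c) a)).
rewrite !rcons_path => /andP[p1 p2]; apply/andP; split.
  apply: (sub_in_path (P := [pred x | x != a])) p1 => [x y|].
    rewrite !inE => xa ya xy; apply: P => //; apply/eqP => xyE.
    have := set21 a b; rewrite -xyE !inE eq_sym (negPf xa).
    by rewrite eq_sym (negPf ya).
  apply/allP => x xb; rewrite inE; apply: contraTneq uc => xa.
  by rewrite /= -xa xb.
apply: P => //; apply/eqP => E; set l := last _ _ in E.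
have lb : l != b.
  have : l \in d :: c by rewrite /l /= mem_last.
  apply: contraTneq => ->; by move: uc => /= /and3P[].
have := set22 a b; rewrite -E !inE eq_sym (negPf lb) eq_sym.
by rewrite (negPf ab).
Qed.

(** Vertices outside [U] are isolated, and [U] contributes at least one more
    component. *)
Lemma graph_rank_inside (U : {set G}) : 0 < #|U| ->
  graph_rank (inside U) <= #|U|.-1.
Proof.
move=> /card_gt0P[u uU]; set s := sub_adj (inside U).
have sS : connect_sym s by exact: sub_adj_csym.
have isol v (z : G) : v \notin U -> connect s v z -> z = v.
  move=> vU /connectP[[|c p] //= /andP[/sub_adjP[f]]].
  rewrite inE => /subsetP fU fE; move: vU.
  by rewrite fU // fE set21.
have sub : fingraph.root s u |: ~: U \subset [set v | roots s v].
  rewrite subUset sub1set inE roots_root //=; apply/subsetP => v.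
  by rewrite !inE => vU; apply/eqP; apply: isol vU _; exact: connect_root.
have k : kappa (inside U) = #|[set v | roots s v]|.
  by apply: eq_card => v; rewrite !inE andbT.
have := subset_leq_card sub; rewrite -k cardsU1.
have -> : fingraph.root s u \notin ~: U.
  rewrite inE negbK; apply: contraLR uU => rU.
  suff -> : u = fingraph.root s u by [].
  by apply: isol rU _; rewrite sS connect_root.
rewrite /graph_rank; have := cardsC U; have : 0 < #|U| by apply/card_gt0P; exists u.
by move: #|_| #|_| #|G| (kappa _) => *; lia.
Qed.

End GraphicRank.

(** * Edmonds' description of the spanning tree polytope *)

Section TreePolytope.
Variables (R : realType) (G : sgraph).
Implicit Types (A B F T M : {set edge G}) (e f : edge G) (v : G).
Implicit Types (w x y h : {ffun edge G -> R^o}).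

(** All linear forms in play are dot products, so that one convexity lemma
    serves for edge sets and degrees alike. *)
Lemma weight_dot x F : weight x F = dot (incidence R F) x.
Proof.
rewrite /weight /dot big_mkcond; apply: eq_bigr => e _.
by rewrite ffunE; case: ifP; rewrite ?mul1r ?mul0r.
Qed.

Lemma weight_incidence F T : weight (incidence R T) F = #|T :&: F|%:R.
Proof.
rewrite /weight -sum1_card natr_sum big_mkcond [RHS]big_mkcond.
by apply: eq_bigr => e _; rewrite ffunE inE; case: (e \in T); case: (e \in F).
Qed.

Lemma dot_incidence w T : dot w (incidence R T) = \sum_(e in T) w e.
Proof. by rewrite dotC -weight_dot. Qed.

Lemma weight_linear F k x y : weight (k *: x + y) F = k * weight x F + weight y F.
Proof. by rewrite !weight_dot dot_linear. Qed.

Lemma deg_weight v x : deg v x = weight x (star v).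
Proof. by apply: eq_bigl => f; rewrite inE. Qed.

(** Spanning trees as bases of the graphic matroid. *)
Definition tree_basis T := independent T && (graph_rank T == #|G|.-1).

(** Abel summation, by induction on the support of [w]: subtract from [w]
    its least positive value on its whole support, which is one of the
    superlevel sets. *)
Lemma dot_le0_superlevel_pos w g : (forall e, 0 <= w e) ->
  (forall t, 0 < t -> weight g [set e | t <= w e] <= 0) -> dot w g <= 0.
Proof.
have [n] := ubnP #|[set e | 0 < w e]|; elim: n w => // n IH w.
have [F0|[e0]] := set_0Vmem [set e | 0 < w e].
  move=> _ w0 _; rewrite /dot big1 // => e _.
  have : e \notin [set e | 0 < w e] by rewrite F0 inE.
  rewrite inE -leNgt => we; have -> : w e = 0 by apply/le_anti; rewrite we w0.
  by rewrite mul0r.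
rewrite inE => e0P; rewrite ltnS => Fn w0 wg.
case: (arg_minP (P := fun e => 0 < w e) w e0P) => e1 /= e1P e1min.
set F := [set e | w e1 <= w e].
have FE : F = [set e | 0 < w e].
  apply/setP => e; rewrite !inE; apply/idP/idP; last exact: e1min.
  exact: lt_le_trans.
pose w' : {ffun edge G -> R^o} := w - w e1 *: incidence R F.
have w'E e : w' e = if e \in F then w e - w e1 else 0.
  rewrite !ffunE; case: ifPn => [_|]; first by rewrite mulr1n [_ *: _]mulr1.
  rewrite FE inE -leNgt => we; rewrite [_ *: _]mulr0 subr0.
  by apply/le_anti; rewrite we w0.
have -> : dot w g = dot w' g + w e1 * weight g F.
  by rewrite weight_dot dotBl dotZl subrK.
have /(IH w') : (#|[set e | (0 < w' e)%R]| < n)%N.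
  apply: leq_trans Fn; apply: proper_card; apply/properP; split.
    apply/subsetP => e; rewrite !inE w'E FE inE; case: ifP => //.
    by rewrite ltxx.
  by exists e1; rewrite !inE // w'E; case: ifP; rewrite ?subrr ltxx.
have := wg _ e1P; rewrite -/F => gF h.
have : dot w' g <= 0.
  apply: h => [e|t t0].
    by rewrite w'E; case: ifP => //; rewrite inE subr_ge0.
  rewrite [X in weight g X](_ : _ = [set e | t + w e1 <= w e]).
    by apply: wg; rewrite addr_gt0.
  apply/setP => e; rewrite !inE w'E; case: ifPn; first by rewrite lerBrDr.
  rewrite inE -ltNge => le; rewrite leNgt t0; apply/esym/negbTE.
  by rewrite -ltNge (lt_trans le) // ltrDr.
have := ler_wpM2l (ltW e1P) gF; lra.
Qed.

(** Adding a constant to [w] changes nothing, as [g] has total 0; this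
    reduces to a nonnegative [w]. *)
Lemma dot_le0_superlevel w g : weight g [set: edge G] = 0 ->
  (forall t, weight g [set e | t <= w e] <= 0) -> dot w g <= 0.
Proof.
move=> gT gw; have [e0 _|E0] := pickP (@predT (edge G)); last first.
  by rewrite /dot big1 // => e; have := E0 e.
case: (arg_minP (P := predT) w (erefl : predT e0)) => e1 _ e1min.
pose m : {ffun edge G -> R^o} := w e1 *: incidence R [set: edge G].
have mE e : m e = w e1 by rewrite !ffunE inE [_ *: _]mulr1.
have -> : dot w g = dot (w - m) g.
  by rewrite dotBl dotZl -weight_dot gT mulr0 subr0.
apply: dot_le0_superlevel_pos => [e|t _].
  by rewrite !ffunE inE [_ *: _]mulr1 subr_ge0 e1min.
rewrite [X in weight g X](_ : _ = [set e | t + w e1 <= w e]) //.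
by apply/setP => e; rewrite !inE !ffunE inE [_ *: _]mulr1 lerBrDr.
Qed.

Lemma tree_polytope_ge0 x e : tree_polytope x -> 0 <= x e.
Proof.
move=> tx; have -> : x e = - dot (- incidence R [set e]) x.
  by rewrite -scaleN1r dotZl mulN1r opprK -weight_dot /weight big_set1.
rewrite oppr_ge0; apply: dot_conv_le tx => y [T _ ->].
rewrite -scaleN1r dotZl mulN1r -weight_dot weight_incidence.
by rewrite oppr_le0.
Qed.

Hypothesis hG : connected_graph G.

Lemma graph_rankT : graph_rank [set: edge G] = #|G|.-1.
Proof.
case: hG => G0 cG; apply/(connected_graph_rank _ G0) => u v.
apply: connect_sub (cG u v) => a b ab; apply: connect1.
by have [e eE] := edge_of_adj ab; apply/sub_adjP; exists e.
Qed.

Lemma spanning_treeP T : spanning_tree T <-> tree_basis T.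
Proof.
case: hG => G0 cG; split=> [[cT acT]|/andP[iT /eqP rT]].
  rewrite /tree_basis forest_independent //=.
  by apply/eqP; apply/(connected_graph_rank _ G0).
split; last exact: independent_forest.
exact/(connected_graph_rank _ G0).
Qed.

Lemma card_tree_basisI T F : tree_basis T -> (#|T :&: F| <= graph_rank F)%N.
Proof.
case/andP => iT _.
have := independentS (subsetIl T F) iT => /eqP <-; exact/graph_rankS/subsetIr.
Qed.

Lemma card_tree_basis T : tree_basis T -> #|T| = #|G|.-1.
Proof. by case/andP => /eqP <- /eqP. Qed.

(** A tree T of maximal weight meets each superlevel set F in a basis of F:
    otherwise an edge e of F can be added to the part of T in F, and completing
    the result to a basis inside T + e exchanges e for an edge outside F, of
    smaller weight. *)
Lemma max_weight_tree w : exists2 T, tree_basis T &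
  forall t, #|T :&: [set e | t <= w e]| = graph_rank [set e | t <= w e].
Proof.
have [B [_ _ iB rB]] : exists B, [/\ set0 \subset B, B \subset [set: edge G],
    independent B & graph_rank B = graph_rank [set: edge G]].
  by apply: independent_extend; rewrite ?sub0set /independent ?graph_rank0 ?cards0.
have BT : tree_basis B by rewrite /tree_basis iB rB graph_rankT eqxx.
case: (arg_maxP (fun T => \sum_(e in T) w e) BT) => T TT Tmax.
exists T => // t; set F := [set e | t <= w e].
apply/eqP; rewrite eqn_leq card_tree_basisI //= leqNgt; apply/negP => lt.
have iTF : independent (T :&: F).
  by apply: independentS (subsetIl T F) _; case/andP: TT.
have [e eF je] : exists2 e, e \in F & ~~ joins (T :&: F) e.
  apply/exists_inP; rewrite -negb_forall_in; apply: contraTN lt => /forall_inP j.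
  by rewrite -leqNgt (graph_rank_closed (subsetIr T F)) // graph_rank_card.
have eTF : e \notin T :&: F by apply: contra je; apply: joins_in.
have eT : e \notin T by apply: contra eTF => eT; rewrite inE eT.
have [||C [IC CT iC rC]] := @independent_extend G (e |: (T :&: F)) (e |: T).
- exact/setUS/subsetIl.
- by rewrite /independent graph_rankU1 je (eqP iTF) cardsU1 eTF addnC.
have {}rC : graph_rank C = #|G|.-1.
  apply/eqP; rewrite rC eqn_leq; case/andP: (TT) => _ /eqP <-.
  rewrite [X in (_ <= X)%N && _](_ : _ = #|G|.-1); last by case/andP: TT => _ /eqP.
  by rewrite -{1}graph_rankT !graph_rankS ?subsetT ?subsetUr.
have TC : tree_basis C by rewrite /tree_basis iC rC eqxx.
have /cards1P[f fE] : #|(e |: T) :\: C| == 1%N.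
  rewrite cardsD (setIidPr CT) cardsU1 eT (card_tree_basis TC) (card_tree_basis TT).
  by rewrite addnK.
have : f \in (e |: T) :\: C by rewrite fE set11.
rewrite !inE => /andP[fC /orP[/eqP fe|fT]].
  by move: fC; rewrite fe (subsetP IC) // setU11.
have fF : w f < t.
  rewrite ltNge; apply: contra fC => ft; apply: (subsetP IC).
  by rewrite !inE fT ft orbT.
have CE : C = (e |: T) :\ f.
  by rewrite -fE setDDr setDv set0U (setIidPr CT).
have : \sum_(g in C) w g <= \sum_(g in T) w g by exact: Tmax.
rewrite leNgt => /negP; apply.
have fe : f \in e |: T by rewrite inE fT orbT.
rewrite -(ltrD2l (w f)) CE -big_setD1 // big_setU1 //= ltrD2r.
by move: eF; rewrite inE; apply: lt_le_trans.
Qed.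

Lemma tree_polytopeP x : tree_polytope x <->
  (weight x [set: edge G] = #|G|%:R - 1 /\
   forall F, weight x F <= (graph_rank F)%:R).
Proof.
have n1 : #|G|%:R - 1 = (#|G|.-1)%:R :> R.
  by case: hG => G0 _; rewrite -{1}(prednK G0) -natr1 addrK.
rewrite n1; split=> [tx|[xT xF]].
  split; last first.
    move=> F; rewrite weight_dot; apply: dot_conv_le tx => y [T /spanning_treeP TT ->].
    by rewrite -weight_dot weight_incidence ler_nat card_tree_basisI.
  apply/le_anti/andP; split.
    rewrite weight_dot; apply: dot_conv_le tx => y [T /spanning_treeP TT ->].
    by rewrite -weight_dot weight_incidence setIT card_tree_basis.
  have -> : weight x setT = - dot (- incidence R [set: edge G]) x.
    by rewrite -scaleN1r dotZl mulN1r opprK weight_dot.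
  rewrite lerNr; apply: dot_conv_le tx => y [T /spanning_treeP TT ->].
  rewrite -scaleN1r dotZl mulN1r -weight_dot weight_incidence setIT.
  by rewrite card_tree_basis.
apply: conv_separation => w b wb.
have [T TT tight] := max_weight_tree w.
apply: le_trans (wb T _); last exact/spanning_treeP.
rewrite -subr_le0 -dotBr; apply: dot_le0_superlevel => [|t].
  rewrite -scaleN1r addrC weight_linear weight_incidence setIT card_tree_basis // xT; lra.
rewrite -scaleN1r addrC weight_linear weight_incidence tight mulN1r.
by rewrite addrC subr_le0.
Qed.

End TreePolytope.

(** * Alternating components of two matchings *)

(** In a graph of maximal degree 2, two walks without repetition that
    start with the same step agree until one of them stops, and they can stop
    only at vertices of degree at most 1, so they stop together. *)
Lemma path_ends_unique (T : eqType) (H : rel T) : symmetric H ->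
  (forall x y1 y2 y3, H x y1 -> H x y2 -> H x y3 ->
     [|| y1 == y2, y1 == y3 | y2 == y3]) ->
  forall p q z x, H x z -> path H x p -> path H x q ->
    uniq (z :: x :: p) -> uniq (z :: x :: q) ->
    (forall y y', H (last x p) y -> H (last x p) y' -> y = y') ->
    (forall y y', H (last x q) y -> H (last x q) y' -> y = y') ->
  last x p = last x q.
Proof.
move=> symH deg2; elim=> [|a p IH] [|b q] z x xz //=.
- move=> _ /andP[xb _] _ /andP[zb _] endx _; move: zb.
  by rewrite (endx _ _ xz xb) !inE eqxx orbT.
- move=> /andP[xa _] _ /andP[za _] _ _ endx; move: za.
  by rewrite (endx _ _ xz xa) !inE eqxx orbT.
move=> /andP[xa pa] /andP[xb qb] /andP[za up] /andP[zb uq].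
have ab : a = b.
  case/or3P: (deg2 _ _ _ _ xz xa xb) => /eqP // E.
    by move: za; rewrite E !inE eqxx orbT.
  by move: zb; rewrite E !inE eqxx orbT.
subst b; apply: (IH q x a) => //; by rewrite symH.
Qed.

Section Matchings.
Variable G : sgraph.
Implicit Types (A B F M N : {set edge G}) (e f : edge G) (u v x y : G).

Definition covers M v := [exists f in M, v \in val f].

Lemma coversP M v : reflect (exists2 f, f \in M & v \in val f) (covers M v).
Proof. exact: exists_inP. Qed.

Lemma matching_eq M f g v : matching M -> f \in M -> g \in M ->
  v \in val f -> v \in val g -> f = g.
Proof.
move=> mM fM gM vf vg; apply/eqP/negPn/negP => fg.
by have /disjointFr/(_ vf) := mM f g fM gM fg; rewrite vg.
Qed.

Lemma matchingS M N : M \subset N -> matching N -> matching M.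
Proof. by move=> /subsetP MN mN f g /MN fN /MN gN; exact: mN. Qed.

Lemma matching_partner M x y y' : matching M ->
  sub_adj M x y -> sub_adj M x y' -> y = y'.
Proof.
move=> mM xy; have := sub_adj_irr M x.
case/sub_adjP: (xy) => f fM fE irr /sub_adjP[g gM gE].
have E : f = g by apply: (matching_eq mM fM gM (v := x)); rewrite ?fE ?gE set21.
apply: (@set2_inj _ x); last by rewrite -fE E.
by apply: contraTneq xy => ->; rewrite sub_adj_irr.
Qed.

Lemma sub_adj_covers M x y : sub_adj M x y -> covers M x.
Proof.
by case/sub_adjP => f fM fE; apply/coversP; exists f; rewrite // fE set21.
Qed.

Lemma sub_adjU M N x y : sub_adj (M :|: N) x y = sub_adj M x y || sub_adj N x y.
Proof.
apply/idP/orP => [/sub_adjP[f]|].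
  by rewrite inE => /orP[] fM fE; [left|right]; apply/sub_adjP; exists f.
by case; apply: sub_adjS; rewrite ?subsetUl ?subsetUr.
Qed.

Lemma card_edge e : #|val e| = 2%N.
Proof.
have [u [v [uv ->]]] := edge_ends e; rewrite cards2.
by case: eqVneq uv => // ->; rewrite adj_irr.
Qed.

Lemma card_matching_star M v : matching M -> #|M :&: star v| = covers M v.
Proof.
move=> mM; case: (boolP (covers M v)) => [/coversP[f fM vf]|/coversP nc].
  apply/eqP/cards1P; exists f; apply/setP => g; rewrite !inE.
  apply/andP/eqP => [[gM vg]|->//].
  exact: matching_eq mM gM fM vg vf.
apply/eqP; rewrite cards_eq0; apply/eqP/setP => g; rewrite !inE.
by apply/negP => /andP[gM vg]; apply: nc; exists g.
Qed.

Lemma card_matching_inside M (U : {set G}) : matching M ->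
  (#|M :&: inside U| * 2)%N = #|[set v in U | covers (M :&: inside U) v]|.
Proof.
move=> mM; set M' := M :&: inside U.
have mM' : matching M' by apply: matchingS mM; exact: subsetIl.
transitivity (\sum_(v in U) #|M' :&: star v|)%N; last first.
  rewrite -sum1_card big_mkcond [RHS]big_mkcond; apply: eq_bigr => v _.
  by rewrite inE; case: (v \in U); rewrite //= card_matching_star //; case: covers.
rewrite -sum_nat_const.
transitivity (\sum_(f in M') \sum_(v in U) (v \in val f : nat))%N.
  apply: eq_bigr => f; rewrite inE => /andP[_]; rewrite inE => fU.
  rewrite -(card_edge f) -sum1_card big_mkcond [RHS]big_mkcond /=.
  apply: eq_bigr => v _; case: (boolP (v \in val f)) => [/(subsetP fU) -> //|].
  by case: ifP.
rewrite exchange_big; apply: eq_bigr => v _.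
rewrite -sum1_card big_mkcond [RHS]big_mkcond; apply: eq_bigr => f _.
rewrite [f \in M' :&: _]inE [f \in star v]inE.
by case: (f \in M'); case: (v \in val f).
Qed.

(** The matchings [M] and [N] are swapped on [C], which is meant to be a
    connected component of their union. *)
Definition exchange (C : {set G}) M N : {set edge G} :=
  [set f : edge G | f \in if val f \subset C then N else M].

Definition edge_closed (C : {set G}) M :=
  forall f v, f \in M -> v \in val f -> v \in C -> val f \subset C.

Lemma exchange_matching C M N : edge_closed C M -> edge_closed C N ->
  matching M -> matching N -> matching (exchange C M N).
Proof.
move=> cM cN mM mN f g; rewrite !inE.
case: ifPn => fC; case: ifPn => gC fM gM fg.
- exact: mN.
- rewrite disjoint_subset; apply/subsetP => v vf; rewrite inE.
  by apply: contra gC => vg; apply: cM vg (subsetP fC _ vf).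
- rewrite disjoint_sym disjoint_subset; apply/subsetP => v vf; rewrite inE.
  by apply: contra fC => vg; apply: cM vg (subsetP gC _ vf).
- exact: mM.
Qed.

Lemma covers_exchange C M N v : edge_closed C M -> edge_closed C N ->
  covers (exchange C M N) v = if v \in C then covers N v else covers M v.
Proof.
move=> cM cN; apply/coversP/idP => [[f]|].
  rewrite inE; case: ifPn => fC fM vf.
    by rewrite (subsetP fC _ vf); apply/coversP; exists f.
  rewrite ifN; first by apply/coversP; exists f.
  by apply: contra fC; exact: cM vf.
case: ifPn => vC /coversP[f fM vf]; exists f => //; rewrite inE.
  by rewrite (cN _ _ fM vf vC).
by rewrite ifN //; apply: contra vC => /subsetP/(_ _ vf).
Qed.

Lemma sum_exchange (R : realType) (w : {ffun edge G -> R^o}) C M N :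
  dot w (incidence R (exchange C M N)) + dot w (incidence R (exchange C N M)) =
  dot w (incidence R M) + dot w (incidence R N).
Proof.
rewrite -!dotDr; apply: eq_bigr => e _; rewrite !ffunE !inE.
by case: ifP => //; rewrite addrC.
Qed.

Definition component M x : {set G} := [set y | connect (sub_adj M) x y].

Lemma component_closed F M x : M \subset F -> edge_closed (component F x) M.
Proof.
move=> MF f v fM vf; rewrite inE => xv; apply/subsetP => y yf; rewrite inE.
apply: connect_trans xv _.
by have /forall_inP/(_ _ vf)/forall_inP/(_ _ yf) := joins_in (subsetP MF _ fM).
Qed.

(** A component of the union of two matchings is a path or a cycle, so it
    does not contain three distinct vertices [a], [u], [v] of degree at most
    1. *)
Lemma component_ends M N a u v : matching M -> matching N ->
  a != u -> a != v -> u != v -> ~~ covers N a -> ~~ covers M u -> ~~ covers M v ->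
  u \in component (M :|: N) a -> v \in component (M :|: N) a -> False.
Proof.
move=> mM mN au av uv Na Mu Mv; set H := sub_adj (M :|: N).
have miss K x y : ~~ covers K x -> sub_adj K x y = false.
  by move=> Kx; apply: contraNF Kx; exact: sub_adj_covers.
have endM x y y' : ~~ covers M x -> H x y -> H x y' -> y = y'.
  by move=> Mx; rewrite /H !sub_adjU !(miss M) //=; exact: matching_partner.
have endN x y y' : ~~ covers N x -> H x y -> H x y' -> y = y'.
  by move=> Nx; rewrite /H !sub_adjU !(miss N) // !orbF; exact: matching_partner.
have deg2 x y1 y2 y3 : H x y1 -> H x y2 -> H x y3 ->
     [|| y1 == y2, y1 == y3 | y2 == y3].
  rewrite /H !sub_adjU => /orP[] h1 /orP[] h2 /orP[] h3; apply/or3P; first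
    [ by apply: Or31; rewrite (matching_partner mM h1 h2)
    | by apply: Or31; rewrite (matching_partner mN h1 h2)
    | by apply: Or32; rewrite (matching_partner mM h1 h3)
    | by apply: Or32; rewrite (matching_partner mN h1 h3)
    | by apply: Or33; rewrite (matching_partner mM h2 h3)
    | by apply: Or33; rewrite (matching_partner mN h2 h3) ].
rewrite !inE => /connectP[p0 /shortenP[p pH up _] uE].
move=> /connectP[q0 /shortenP[q qH uq _] vE] {p0 q0}.
case: p q pH qH up uq uE vE => [|x p] [|y q] //=.
- by move=> _ _ _ _ ua; rewrite ua eqxx in au.
- by move=> _ _ _ _ ua; rewrite ua eqxx in au.
- by move=> _ _ _ _ _ va; rewrite va eqxx in av.
move=> /andP[ax pH] /andP[ay qH] up uq uE vE.
have xy := endN _ _ _ Na ax ay; rewrite -{}xy in ay qH uq vE.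
have xa : H x a by rewrite /H sub_adj_sym.
have := path_ends_unique (@sub_adj_sym _ _) deg2 xa pH qH up uq.
rewrite -uE -vE => E; move: uv; rewrite E ?eqxx // => z z'; exact: endM.
Qed.
End Matchings.

(** * Edmonds' description of the matching polytope *)

Section MatchingPolytope.
Variables (R : realType) (G : sgraph).
Implicit Types (A B F M N : {set edge G}) (e f : edge G) (u v : G).

Section MaxWeight.
Variables (w : {ffun edge G -> R^o}) (b : R).
Hypothesis wb : forall M, matching M -> dot w (incidence R M) <= b.

(** With [b] an upper bound for the weights of matchings, these are the
    matchings of maximal weight, or there are none. *)
Definition optimal M := matching M /\ dot w (incidence R M) = b.

(** The exchanges of [M] and [N] and of [N] and [M] have the same total
    weight as [M] and [N], so both of them are optimal. *)
Lemma optimal_exchange C M N : edge_closed C M -> edge_closed C N ->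
  optimal M -> optimal N -> optimal (exchange C M N).
Proof.
move=> cM cN [mM wM] [mN wN]; have mE := exchange_matching cM cN mM mN.
split=> //; apply/le_anti; rewrite wb //=.
have := wb (exchange_matching cN cM mN mM).
have := sum_exchange w C M N; lra.
Qed.

Lemma optimal_avoids_negative M e : optimal M -> w e < 0 -> e \notin M.
Proof.
move=> [mM wM] we; apply/negP => eM.
have := wb (matchingS (subD1set M e) mM).
by rewrite -wM !dot_incidence (big_setD1 e eM) /=; lra.
Qed.

Definition positive : {set edge G} := [set e | 0 < w e].

(** Otherwise adding the edge would increase the weight. *)
Lemma optimal_covers_edge_end M u v : optimal M -> sub_adj positive u v ->
  ~~ covers M u -> covers M v.
Proof.
move=> [mM wM] /sub_adjP[e]; rewrite inE => we eE Mu; apply: contraT => Mv; exfalso.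
have dis f : f \in M -> [disjoint val e & val f].
  move=> fM; rewrite disjoint_subset eE; apply/subsetP => x.
  rewrite !inE => /orP[] /eqP ->; [apply: contra Mu|apply: contra Mv] => xf;
  by apply/coversP; exists f.
have eM : e \notin M.
  by apply: contra Mu => eM; apply/coversP; exists e; rewrite // eE set21.
have : dot w (incidence R (e |: M)) <= b.
  apply: wb => f g; rewrite !inE => /orP[/eqP->|fM] /orP[/eqP->|gM] fg.
  - by rewrite eqxx in fg.
  - exact: dis.
  - by rewrite disjoint_sym; exact: dis.
  - exact: mM.
by rewrite -wM !dot_incidence big_setU1 //=; lra.
Qed.

Hypothesis missed : forall v, exists2 M, optimal M & ~~ covers M v.

(** Lovasz's argument, by induction on a path of edges of positive weight.
    Suppose that [M] misses both ends u and v, let a be the second vertex of the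
    path, and let [N] be an optimal matching that misses a. The component of a
    in the union of [M] and [N] does not contain both u and v. Exchanging along
    it gives an optimal matching that misses a together with u or v, against
    the case of an edge or the induction hypothesis. *)
Lemma optimal_covers_path_end p u M : path (sub_adj positive) u p -> u != last u p ->
  optimal M -> ~~ covers M u -> covers M (last u p).
Proof.
elim: p u M => [|a p IH] u M /=; first by rewrite eqxx.
move=> /andP[ua pa] uv oM Mu; set v := last a p in uv *.
have [<-|av] := eqVneq a v; first exact: optimal_covers_edge_end ua Mu.
have au : a != u by apply: contraTneq ua => ->; rewrite sub_adj_irr.
have [N oN Na] := missed a.
apply: contraT => Mv; exfalso; set C := component (M :|: N) a.
have cM : edge_closed C M by apply: component_closed; exact: subsetUl.
have cN : edge_closed C N by apply: component_closed; exact: subsetUr.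
have aC : a \in C by rewrite inE connect0.
have oE := optimal_exchange cM cN oM oN.
have Ea : ~~ covers (exchange C M N) a by rewrite covers_exchange // aC.
apply: (component_ends (proj1 oM) (proj1 oN) au av uv Na Mu Mv).
  apply/negPn/negP => uC.
  rewrite sub_adj_sym in ua; have := optimal_covers_edge_end oE ua Ea.
  by rewrite covers_exchange // (negPf uC) (negPf Mu).
apply/negPn/negP => vC.
by have := IH _ _ pa av oE Ea; rewrite covers_exchange // (negPf vC) (negPf Mv).
Qed.

Hypothesis w0 : forall e, 0 <= w e.

Lemma optimal_positive M : optimal M -> optimal (M :&: positive).
Proof.
move=> [mM wM]; split; first by apply: matchingS mM; exact: subsetIl.
rewrite -wM; apply: eq_bigr => e _; rewrite !ffunE !inE.
case: (e \in M) => //=; have := w0 e; rewrite le_eqVlt.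
by case: eqVneq => [<-|_ /= ->] //; rewrite !mul0r.
Qed.

(** The edges of weight 0 can be dropped from an optimal matching, and the
    others do not leave the component [U]. So each optimal matching leaves at
    most one vertex of [U] unmatched within [U]; one that misses [x] leaves
    exactly one, which makes [U] odd, and then by parity all of them do. *)
Lemma optimal_near_perfect x (U := component positive x) M : optimal M ->
  odd #|U| /\ #|M :&: inside U| = #|U|./2.
Proof.
pose C M := [set v in U | covers (M :&: inside U) v].
have posU N : edge_closed U (N :&: positive).
  by apply: component_closed; exact: subsetIr.
have CU N : (#|C N| + #|U :\: C N|)%N = #|U|.
  have CsU : C N \subset U by apply/subsetP => v; rewrite inE => /andP[].
  by rewrite -(cardsID (C N) U) (setIidPr CsU).
have missC N v : v \in U :\: C N -> v \in U /\ ~~ covers (N :&: positive) v.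
  rewrite in_setD [v \in C N]inE; case: (boolP (v \in U)) => [vU|_]; last first.
    by rewrite andbF.
  rewrite andbT => /= nC; split=> //; apply: contra nC => /coversP[f fN vf].
  have fU := posU _ _ _ fN vf vU.
  by apply/coversP; exists f => //; move: fN; rewrite !inE fU => /andP[->].
have UC N : optimal N -> (#|U :\: C N| <= 1)%N.
  move=> /optimal_positive oN; rewrite leqNgt; apply/negP => /card_gt1P[u [v]].
  move=> [/missC[uU Nu] /missC[vU Nv] uv].
  have : connect (sub_adj positive) u v.
    by move: uU vU; rewrite !inE sub_adj_csym; exact: connect_trans.
  case/connectP => p pP vE; rewrite vE in uv Nv.
  by have := optimal_covers_path_end pP uv oN Nu; rewrite (negPf Nv).
have even N : optimal N -> (#|N :&: inside U| * 2)%N = #|C N|.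
  by move=> [mN _]; exact: card_matching_inside.
have oddU : odd #|U|.
  have [N oN Nx] := missed x.
  have : x \in U :\: C N.
    rewrite in_setD [x \in C N]inE [x \in U]inE connect0 /= andbT.
    apply: contra Nx => /coversP[f].
    by rewrite inE => /andP[fN _] xf; apply/coversP; exists f.
  move=> xUC; rewrite -(CU N) -even //.
  suff -> : #|U :\: C N| = 1%N by rewrite oddD oddM andbF.
  apply/eqP; rewrite eqn_leq UC //=; by apply/card_gt0P; exists x.
move=> oM; split=> //; have := UC M oM; have := CU M; have := even M oM.
move: (odd_double_half #|U|); rewrite oddU -muln2.
by move: #|U|./2 #|U| #|_ :&: _| #|C M| #|_ :\: _| => *; lia.
Qed.

End MaxWeight.

(** Given an inequality w.p <= b that the matchings satisfy and [z]
    violates, one of the following holds on all matchings of weight b, and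
    gives the inequality required by [conv_facets]: they avoid an edge of
    negative weight; they cover a common vertex; or they match all but one
    vertex of a component of the edges of positive weight. *)
Lemma matching_polytope_sufficient (z : {ffun edge G -> R^o}) :
  (forall e, 0 <= z e) -> (forall v, weight z (star v) <= 1) ->
  (forall U : {set G}, odd #|U| -> weight z (inside U) <= (#|U|./2)%:R) ->
  matching_polytope z.
Proof.
move=> z0 z1 zU; apply: conv_facets => w b wb wz.
have m0 : matching (set0 : {set edge G}) by move=> f g; rewrite inE.
have dotI F M : dot (incidence R F) (incidence R M) = #|M :&: F|%:R.
  by rewrite -weight_dot weight_incidence.
have [[e we]|w0] := pselect (exists e, w e < 0).
  exists (- incidence R [set e]), 0.
  have dN y : dot (- incidence R [set e]) y = - weight y [set e].
    by rewrite -scaleN1r dotZl mulN1r weight_dot.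
  split=> [M mM||M mM wM|].
  - by rewrite dN weight_incidence oppr_le0.
  - by rewrite dN /weight big_set1 oppr_le0.
  - rewrite dN weight_incidence.
    have /(_ M) := @optimal_avoids_negative w b wb _ e _ we.
    move=> /(_ (conj mM wM)) eM.
    rewrite (_ : M :&: [set e] = set0) ?cards0 ?oppr0 //.
    by apply/setP => f; rewrite !inE; case: eqP => [->|]; rewrite ?andbF ?(negPf eM).
  exists [set e]; first by move=> f g; rewrite !inE => /eqP -> /eqP ->; rewrite eqxx.
  by rewrite dN weight_incidence setIid cards1 oppr_lt0.
have {}w0 e : 0 <= w e by rewrite leNgt; apply/negP => we; apply: w0; exists e.
have [[v vM]|nv] := pselect (exists v, forall M, optimal w b M -> covers M v).
  exists (incidence R (star v)), 1; split=> [M mM||M mM wM|].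
  - by rewrite dotI card_matching_star // lern1 leq_b1.
  - by rewrite -weight_dot.
  - by rewrite dotI card_matching_star // vM.
  exists set0 => //; by rewrite dotI set0I cards0.
have miss v : exists2 M, optimal w b M & ~~ covers M v.
  apply: contrapT => nM; apply: nv; exists v => M oM.
  by apply: contraT => Mv; case: nM; exists M.
have [e0 we0] : exists e, 0 < w e.
  apply: contrapT => we; have := wb _ m0.
  rewrite dot_incidence big_set0 leNgt => /negP; apply.
  apply: lt_le_trans wz _; rewrite /dot big1 // => e _.
  suff -> : w e = 0 by rewrite mul0r.
  by apply/le_anti; rewrite w0 leNgt andbT; apply/negP => ?; apply: we; exists e.
have [u [v [uv eE]]] := edge_ends e0.
pose U := component (positive w) u.
have cU M oM := optimal_near_perfect wb miss w0 u (M := M) oM.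
have [M0 oM0 _] := miss u; have [oddU _] := cU _ oM0.
have U1 : (1 < #|U|)%N.
  apply/card_gt1P; exists u, v; split.
  - by rewrite inE connect0.
  - by rewrite inE connect1 //; apply/sub_adjP; exists e0; rewrite ?inE.
  - by apply: contraTneq uv => ->; rewrite adj_irr.
exists (incidence R (inside U)), (#|U|./2)%:R; split=> [M mM||M mM wM|].
- rewrite dotI ler_nat; have := card_matching_inside U mM.
  have : (#|[set x in U | covers (M :&: inside U) x]| <= #|U|)%N.
    by apply/subset_leq_card/subsetP => x; rewrite inE => /andP[].
  move: (odd_double_half #|U|); rewrite oddU -muln2.
  by move: #|U|./2 #|U| #|_ :&: _| #|[set _ in _ | _]| => *; lia.
- by rewrite -weight_dot zU.
- by rewrite dotI; have [_ ->] := cU M (conj mM wM).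
exists set0 => //; rewrite dotI set0I cards0 ltr0n.
by rewrite half_gt0.
Qed.

End MatchingPolytope.

(** * Maximal chains of tight sets and vertices *)

Section Chains.
Variables (E : finType) (V : zmodType) (T : pred {set E}).
Implicit Types (A B F : {set E}) (L : {set {set E}}).

Definition chain_in L :=
  [forall A in L, T A && [forall B in L, (A \subset B) || (B \subset A)]].

Lemma chain_inP L :
  reflect ((forall A, A \in L -> T A) /\
           {in L &, forall A B, A \subset B \/ B \subset A}) (chain_in L).
Proof.
apply: (iffP forall_inP) => [H|[LT LC] A AL].
  split=> [A /H/andP[]//|A B /H/andP[_ /forall_inP AB] /AB]; exact/orP.
by rewrite LT //=; apply/forall_inP => B BL; apply/orP/LC.
Qed.

Hypothesis TI : forall A B, T A -> T B -> T (A :&: B).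
Hypothesis TU : forall A B, T A -> T B -> T (A :|: B).

(** Otherwise [A] could be added to the chain. *)
Lemma mem_maxchain L A : maxset chain_in L -> T A ->
  (forall B, B \in L -> A \subset B \/ B \subset A) -> A \in L.
Proof.
move=> /maxsetP[/chain_inP[LT LC] max] TA AL; rewrite -(max (A |: L)) ?setU11 //.
  apply/chain_inP; split=> [B|B C]; rewrite !inE.
    by case/orP => [/eqP ->|/LT].
  move=> /orP[/eqP ->|BL] /orP[/eqP ->|CL]; [by left|exact: AL| |exact: LC].
  by have [] := AL B BL; [right|left].
exact: subsetUr.
Qed.

Hypotheses (T0 : T set0) (TT : T setT).

(** By induction on a member [X] of the chain, the sum of [h] over the part
    of [F] in [X] is 0. Let [Y] be the next smaller member. The union of [Y] and
    of the part of [F] in [X] belongs to the lattice and lies between [Y] and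
    [X], so by maximality it is [Y] or [X]; that is, [F] contains none or all of
    the difference of [X] and [Y]. *)
Lemma sum_eq0_maxchain L (h : E -> V) F : maxset chain_in L ->
  (forall A, A \in L -> \sum_(e in A) h e = 0) -> T F -> \sum_(e in F) h e = 0.
Proof.
move=> mL hL TF.
have [/chain_inP[LT LC] _] := maxsetP mL.
have L0 : set0 \in L by apply: mem_maxchain => // B _; left; exact: sub0set.
have L1 : setT \in L by apply: mem_maxchain => // B _; right; exact: subsetT.
suff claim X : X \in L -> \sum_(e in F :&: X) h e = 0.
  by rewrite -[F]setIT claim.
have [n] := ubnP #|X|; elim: n X => // n IH X Xn XL.
have [->|X0] := eqVneq X set0; first by rewrite setI0 big_set0.
pose Q A := (A \in L) && (A \proper X).
have Q0 : Q set0 by rewrite /Q L0 proper0.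
case: (arg_maxnP (fun A => #|A|) Q0) => Y /andP[YL YX] Ymax.
have sYX := proper_sub YX.
have hY : \sum_(e in F :&: Y) h e = 0.
  by apply: IH => //; apply: leq_trans (proper_card YX) _.
have below A : A \in L -> A \proper X -> A \subset Y.
  move=> AL AX; have [//|YA] := LC _ _ AL YL.
  suff -> : A = Y by [].
  apply/esym/eqP; rewrite eqEcard YA; apply: Ymax; exact/andP.
(* the test set that refines the chain between [Y] and [X] *)
pose W := Y :|: (F :&: X).
have WX : W \subset X by rewrite subUset sYX subsetIr.
have WL : W \in L.
  apply: mem_maxchain => // [|B BL].
    by apply: TU; [exact: LT|apply: TI; [|exact: LT]].
  have [XB|BX] := LC _ _ XL BL; first by left; apply: subset_trans XB.
  have [->|nBX] := eqVneq B X; first by left.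
  right; apply: subset_trans (subsetUl _ _); apply: below => //.
  by rewrite properEneq nBX.
have [WE|nWX] := eqVneq W X.
  rewrite (big_setID Y) /= -setIA (setIidPr sYX).
  have -> : (F :&: X) :\: Y = X :\: Y.
    apply/setP => e; have := congr1 (fun A : {set E} => e \in A) WE.
    rewrite !inE; by case: (e \in Y); case: (e \in F).
  rewrite hY add0r; have := hL X XL.
  by rewrite (big_setID Y) /= (setIidPr sYX) (hL Y YL) add0r.
have WY : W \subset Y by apply: below => //; rewrite properEneq nWX.
suff -> : F :&: X = F :&: Y by [].
apply/setP => e; have /implyP := subsetP sYX e; have /implyP := subsetP WY e.
by rewrite !inE; case: (e \in Y); case: (e \in F); case: (e \in X).
Qed.

End Chains.

(** Slacks [s] and rates [a]: a direction that keeps the tight constraints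
    tight can be followed a little way, forwards and backwards. *)
Lemma feasible_step (R : realFieldType) (I : finType) (s a : I -> R) :
  (forall i, 0 <= s i) -> (forall i, s i = 0 -> a i = 0) ->
  exists2 t, 0 < t & forall i, t * `|a i| <= s i.
Proof.
move=> s0 sa; pose r i := `|a i| / s i.
have r0 i : 0 <= r i by rewrite divr_ge0.
have S0 : 0 < 1 + \sum_i r i by rewrite ltr_wpDr ?ltr01 // sumr_ge0.
exists (1 + \sum_i r i)^-1 => [|i]; first by rewrite invr_gt0.
have [si|si] := eqVneq (s i) 0; first by rewrite sa // normr0 mulr0.
rewrite mulrC ler_pdivrMr // mulrC -ler_pdivrMr ?lt_neqAle ?s0 ?[0 == _]eq_sym ?si //.
rewrite -/(r i) (bigD1 i) //= addrCA lerDl addr_ge0 // sumr_ge0 //.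
Qed.

Section Theta.
Variables (R : realType) (G : sgraph).
Hypothesis hG : connected_graph G.
Implicit Types (A B F M : {set edge G}) (e f : edge G) (v : G).
Implicit Types (x y h : {ffun edge G -> R^o}).

(** The rank inequality for the edges inside an odd set [U] is twice
    Edmonds' inequality for [U], so on the spanning tree polytope the degree
    conditions are all that remains of membership in the doubled matching
    polytope. *)
Lemma tree_double_matching_polytopeP x : tree_double_matching_polytope x <->
  (tree_polytope x /\ forall v, deg v x <= 2).
Proof.
split=> [[tx [y my xE]]|[tx x2]]; split=> //.
  move=> v; rewrite xE deg_weight weight_dot dotZr -[leRHS]mulr1 ler_wpM2l //.
  apply: dot_conv_le my => z [M mM ->].
  by rewrite -weight_dot weight_incidence card_matching_star // lern1 leq_b1.
have wZ F : weight (2^-1 *: x) F = 2^-1 * weight x F.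
  by rewrite !weight_dot dotZr.
exists (2^-1 *: x); last by rewrite scalerA divff ?pnatr_eq0 // scale1r.
apply: matching_polytope_sufficient => [e|v|U oU].
- by rewrite ffunE mulr_ge0 // ?invr_ge0 // tree_polytope_ge0.
- have := x2 v; rewrite deg_weight wZ; lra.
have [_ /(_ (inside U)) xU] := (tree_polytopeP hG x).1 tx.
have U0 : (0 < #|U|)%N by case: #|U| oU.
have rU : (graph_rank (inside U))%:R <= (#|U|.-1)%:R :> R.
  by rewrite ler_nat graph_rank_inside.
have UE : (#|U|.-1)%:R = 2 * (#|U|./2)%:R :> R.
  by rewrite -{1}(odd_double_half #|U|) oU /= -muln2 natrM mulrC.
rewrite wZ; lra.
Qed.

Definition tight x F := weight x F == (graph_rank F)%:R.

Lemma weightUI x A B :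
  weight x (A :|: B) + weight x (A :&: B) = weight x A + weight x B.
Proof.
rewrite !weight_dot -!(dotC x) -!dotDr; apply: eq_bigr => e _.
rewrite !ffunE !inE.
by case: (e \in A); case: (e \in B); rewrite /= ?addr0 ?add0r.
Qed.

(** Submodularity of the rank against modularity of the weight. *)
Lemma tightUI x A B : tree_polytope x -> tight x A -> tight x B ->
  tight x (A :|: B) /\ tight x (A :&: B).
Proof.
move=> /(tree_polytopeP hG)[_ xr] /eqP xA /eqP xB.
have := weightUI x A B; have := xr (A :|: B); have := xr (A :&: B).
have : (graph_rank (A :&: B) + graph_rank (A :|: B))%:R
    <= (graph_rank A + graph_rank B)%:R :> R by rewrite ler_nat graph_rank_submod.
rewrite !natrD /tight xA xB => *; split; apply/eqP; lra.
Qed.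

End Theta.

Theorem theorem3p2 (R : realType) (G : sgraph) (hG : connected_graph G)
    (x : {ffun edge G -> R^o}) :
  is_vertex (@tree_double_matching_polytope G R) x <->
  (tree_polytope x /\ forall v : G, deg v x <= 2) /\
  (exists (L : {set {set edge G}}) (Z : {set edge G}) (D : {set G}),
    [/\ laminar L, set0 \notin L, [set: edge G] \notin L,
        linear_system L Z D x
      & forall y : {ffun edge G -> R^o}, linear_system L Z D y -> y = x]).
Proof.
have tdmP := @tree_double_matching_polytopeP R G hG.
have tP := @tree_polytopeP R G hG.
split=> [[/tdmP[tx x2] xext]|[[tx x2] [L [Z [D [_ _ _ [xE xL xZ xD] xuniq]]]]]].
  split=> //; have [xE xr] := (tP x).1 tx.
  have tight0 : tight x set0 by rewrite /tight /weight big_set0 graph_rank0.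
  have tightT : tight x setT.
    rewrite /tight xE graph_rankT //; case: (hG) => G0 _.
    by rewrite -{1}(prednK G0) -natr1 addrK.
  have [C mC _] : {C | maxset (chain_in (tight x)) C & set0 \subset C}.
    by apply: maxset_exists; apply/chain_inP; split=> A; rewrite inE.
  have [/chain_inP[Ct Cc] _] := maxsetP mC.
  pose D := [set v | deg v x == 2].
  exists (C :\: [set set0; setT]), set0, D; split.
  - move=> A B; rewrite !inE => /andP[_ AC] /andP[_ BC].
    by have [] := Cc _ _ AC BC; [exact: Or32|exact: Or33].
  - by rewrite !inE eqxx.
  - by rewrite !inE eqxx orbT.
  - split=> [//|A|e|v]; rewrite !inE //; last by move/eqP.
    by move=> /andP[_ /Ct/eqP].
  move=> y [yE yL _ yD]; pose h := y - x.
  have wh F : weight h F = weight y F - weight x F.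
    by rewrite !weight_dot dotBr.
  have hC A : A \in C -> weight h A = 0.
    move=> AC; rewrite wh; apply/eqP; rewrite subr_eq0.
    have [->|A0] := eqVneq A set0; first by rewrite /weight !big_set0.
    have [->|A1] := eqVneq A setT; first by rewrite yE xE.
    by rewrite (eqP (Ct A AC)) yL // !inE negb_or A0 A1.
  have ht F : tight x F -> weight h F = 0.
    apply: (sum_eq0_maxchain _ _ tight0 tightT mC hC) => A B At Bt.
    - by have [] := tightUI hG tx At Bt.
    - by have [] := tightUI hG tx At Bt.
  have hD v : deg v x = 2 -> deg v h = 0.
    by move=> vx; rewrite deg_weight wh -!deg_weight vx yD ?subrr // inE vx.
  (* the inequalities of the polytope, indexed by edge sets and vertices:
     [s] is their slack at [x], [a] their rate of change along [h] *)
  pose s (i : {set edge G} + G) := match i with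
    | inl F => (graph_rank F)%:R - weight x F | inr v => 2 - deg v x end.
  pose a (i : {set edge G} + G) := match i with
    | inl F => weight h F | inr v => deg v h end.
  have [[F|v]|[F|v]|t t0 ta] := @feasible_step _ _ s a.
  - by rewrite /= subr_ge0.
  - by rewrite /= subr_ge0.
  - by move=> /= /eqP; rewrite subr_eq0 => /eqP sF; apply: ht; rewrite /tight sF.
  - by move=> /= /eqP; rewrite subr_eq0 => /eqP sF; apply: hD.
  have step c : `|c| = t -> tree_double_matching_polytope (c *: h + x).
    move=> ct; have bnd i : c * a i <= s i.
      by apply: le_trans (ta i); rewrite -ct -normrM ler_norm.
    apply/tdmP; split; last first.
      by move=> v; have := bnd (inr v); rewrite /= !deg_weight weight_linear; lra.
    apply/tP; split=> [|F]; rewrite weight_linear.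
      by rewrite (ht _ tightT) mulr0 add0r.
    by have := bnd (inl F); rewrite /=; lra.
  have half : 0 < (2^-1 : R) < 1 by apply/andP; split; lra.
  have nt : `|t| = t by rewrite gtr0_norm.
  have nNt : `|- t| = t by rewrite normrN.
  have xE2 : x = 2^-1 *: (t *: h + x) + (1 - 2^-1) *: (- t *: h + x).
    have -> : 1 - 2^-1 = 2^-1 :> R by lra.
    rewrite -scalerDr scaleNr addrACA subrr add0r -mulr2n -scaler_nat scalerA.
    by rewrite mulVf ?scale1r ?pnatr_eq0.
  have /addIr/eqP := xext _ _ _ (step _ nt) (step _ nNt) half xE2.
  rewrite -subr_eq0 scaleNr opprK -scalerDl.
  rewrite scaler_eq0 => /orP[|]; first by rewrite gt_eqF // addr_gt0.
  by rewrite subr_eq0 => /eqP.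
split; first exact/tdmP.
move=> y z t /tdmP[ty y2] /tdmP[tz z2] /andP[t0 t1] xyz.
have [yE yr] := (tP y).1 ty; have [zE zr] := (tP z).1 tz.
have squeeze (p q b : R) : p <= b -> q <= b -> t * p + (1 - t) * q = b ->
    p = b /\ q = b.
  move=> pb qb E; split; apply/le_anti; rewrite ?pb ?qb /=; nra.
have wx F : weight x F = t * weight y F + (1 - t) * weight z F.
  by rewrite xyz !weight_dot dot_linear dotZr.
have zero e : e \in Z -> y e = 0 /\ z e = 0.
  move=> /xZ xe; have := tree_polytope_ge0 e ty; have := tree_polytope_ge0 e tz.
  have : x e = t * y e + (1 - t) * z e by rewrite {1}xyz !ffunE.
  rewrite xe => E ze ye; split; nra.
suff [yx zx] : linear_system L Z D y /\ linear_system L Z D z.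
  by rewrite (xuniq y) // (xuniq z).
split; split=> // [F FL|e /zero[]//|v vD].
- by have [] := squeeze _ _ _ (yr F) (zr F) (esym (etrans (esym (xL F FL)) (wx F))).
- have := xD v vD; rewrite deg_weight wx -!deg_weight => xv.
  by have [] := squeeze _ _ _ (y2 v) (z2 v) xv.
- by have [] := squeeze _ _ _ (yr F) (zr F) (esym (etrans (esym (xL F FL)) (wx F))).
- have := xD v vD; rewrite deg_weight wx -!deg_weight => xv.
  by have [] := squeeze _ _ _ (y2 v) (z2 v) xv.
Qed.
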